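(* Consider a network of $N=N_1+N_2$ clusters divided into Group 1 (clusters $1,\dots,N_1$) and Group 2 (clusters $N_1+1,\dots,N$), with self-consistent transfer operator $\mathcal F:\mathcal M_1^N\to\mathcal M_1^N$ given by twice continuously differentiable $f_i:\mathbb T\to\mathbb T$ and $h_{ij}:\mathbb T\times\mathbb T\to\mathbb R$, and, for $\boldsymbol\mu\in\mathcal M_1^{N_1}$, let $G_{\boldsymbol\mu}:\mathbb T^{N_2}\to\mathbb T^{N_2}$ and $g_{\boldsymbol\mu,i}:\mathbb T^{N_2}\to\mathbb R$, $i=1,\dots,N_2$, be as defined in the context. Suppose that there are $\mathcal N'\subset\mathcal M_1^{N_1}$, $U\subset\mathbb T^{N_2}$, $\epsilon_0>0$, $\delta>0$ and $\lambda\in[0,1)$ such that A1) for every $\boldsymbol\mu\in\mathcal N'$, $G_{\boldsymbol\mu}(U)\subset U$, $d(G_{\boldsymbol\mu}(\overline U),\partial U)>\delta$, and $|g_{\boldsymbol\mu,i}(\boldsymbol x)|\le\lambda$ for all $\boldsymbol x\in U$ and all $i$; A2) letting $\mathcal S_{\epsilon,U}:=\{\boldsymbol\nu\in\mathcal M_1^{N_2}:|\operatorname{supp}\boldsymbol\nu|_\infty<\epsilon,\ \operatorname{supp}\boldsymbol\nu\subset U\}$, there is $\mathcal N\subset\mathcal N'$ such that $$\Pi_1\mathcal F^n(\mathcal N\times\mathcal S_{\epsilon,U})\subset\mathcal N'\qquad\forall n\in\mathbb N,\ \forall\epsilon\in(0,\epsilon_0].$$ Then there is $\epsilon\in(0,\epsilon_0]$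 such that if $(\boldsymbol\mu,\boldsymbol\nu)\in\mathcal N\times\mathcal S_{\epsilon,U}$, then $$\lim_{n\to\infty}d_W\big(\mathcal F^n(\boldsymbol\mu,\boldsymbol\nu),\mathcal{PS}_U\big)=0.$$
   Context: $\mathbb T=\mathbb R/\mathbb Z$ is the circle; $d$ denotes the distance on $\mathbb T^{N_2}$, and the distance between sets is the infimum of pointwise distances; $\overline U$ and $\partial U$ are the closure and boundary of $U$. Here $N_1,N_2\ge1$. $\mathcal M_1$ is the set of Borel probability measures on $\mathbb T$. For a measurable map $T:\mathbb T\to\mathbb T$, its transfer operator is the push-forward $T_*\mu=\mu\circ T^{-1}$. Self-consistent operator: for $\boldsymbol\eta=(\eta_1,\dots,\eta_N)\in\mathcal M_1^N$ put $$F_{\boldsymbol\eta,i}(x)=f_i\Big(x+\sum_{j=1}^N\int_{\mathbb T}h_{ij}(x,y)\,d\eta_j(y)\Big),\qquad \mathcal F\boldsymbol\eta=\big(F_{\boldsymbol\eta,1*}\eta_1,\dots,F_{\boldsymbol\eta,N*}\eta_N\big).$$ $\Pi_1:\mathcal M_1^N\to\mathcal M_1^{N_1}$ and $\Pi_2:\mathcal M_1^N\to\mathcal M_1^{N_2}$ are the projections onto the first $N_1$ and last $N_2$ coordinates. For fixed $\boldsymbol\mu\in\mathcal M_1^{N_1}$, $\mathcal F_{2,\boldsymbol\mu}:\mathcal M_1^{N_2}\to\mathcal M_1^{N_2}$ is $\mathcal F_{2,\boldsymbol\mu}\boldsymbol\nu=\Pi_2\mathcal F(\boldsymbol\mu,\boldsymbol\nu)$.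 The map $G_{\boldsymbol\mu}$ is defined by $G_{\boldsymbol\mu}(\boldsymbol x)=\boldsymbol x'$ where $\mathcal F_{2,\boldsymbol\mu}(\delta_{x_1},\dots,\delta_{x_{N_2}})=(\delta_{x_1'},\dots,\delta_{x_{N_2}'})$, and $$g_{\boldsymbol\mu,i}(\boldsymbol x)=\big(F_{(\boldsymbol\mu,\delta_{x_1},\dots,\delta_{x_{N_2}}),\,N_1+i}\big)'(x_i),\qquad i=1,\dots,N_2,$$ the derivative being taken in the circle variable with the measures held fixed. Wasserstein distance: for $\mu,\nu\in\mathcal M_1$, $d_W(\mu,\nu)=\sup_{\varphi}\int\varphi\,d(\mu-\nu)$ over $\varphi:\mathbb T\to\mathbb R$ with Lipschitz constant at most $1$; on $\mathcal M_1^N$, $d_W(\boldsymbol\mu,\boldsymbol\nu)=\max_i d_W(\mu_i,\nu_i)$; the distance to a set is the infimum of the distances to its elements. Supports: for $\boldsymbol\nu=(\nu_1,\dots,\nu_{N_2})$, $\operatorname{supp}\boldsymbol\nu=\operatorname{supp}\nu_1\times\dots\times\operatorname{supp}\nu_{N_2}$ (topological supports), $|\operatorname{supp}\nu_i|=\inf\{|I|: I\text{ an arc with }\operatorname{supp}\nu_i\subset I\}$ where $|I|$ is arc length, and $|\operatorname{supp}\boldsymbol\nu|_\infty=\max_i|\operatorname{supp}\nu_i|$. $\mathcal{PS}_U=\mathcal M_1^{N_1}\times\{(\delta_{x_1},\dots,\delta_{x_{N_2}}):\boldsymbol x\in U\}\subset\mathcal M_1^N$ is the set of partially synchronized states in $U$.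 *)

(* Defs.v *)
From HB Require Import structures.
From mathcomp Require Import all_boot all_order all_algebra.
From mathcomp Require Import generic_quotient ring_quotient archimedean.
From mathcomp Require Import lra.
From mathcomp Require Import all_classical all_reals all_analysis.

Set Implicit Arguments.
Unset Strict Implicit.
Unset Printing Implicit Defensive.

Import Order.TTheory GRing.Theory Num.Theory.
Import numFieldNormedType.Exports.

Local Open Scope classical_set_scope.
Local Open Scope ring_scope.
Local Open Scope quotient_scope.

Definition int_subgroup (R : realType) : zmodClosed R :=
  GRing.ZmodClosed.clone R (@Num.int_num_subdef R : {pred R}) _.

Definition circle (R : realType) : Type := Quotient.quot (int_subgroup R).

Section circle_metric.
Variable R : realType.

HB.instance Definition _ := GRing.Zmodule.on (circle R).
HB.instance Definition _ := isPointed.Build (circle R) 0.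

Definition cproj (t : R) : circle R :=
  \pi_(Quotient.quot (int_subgroup R)) t.

(* The representative in [-1/2, 1/2), used as a chart around 0. *)
Definition crep (x : circle R) : R :=
  let t := repr (x : Quotient.quot (int_subgroup R)) in
  t - (Num.floor (t + 2^-1))%:~R.

Definition cdist (x y : circle R) : R := `|crep (x - y)|.

Fact cproj_is_zmod_morphism : zmod_morphism cproj.
Proof. by move=> s t; rewrite /cproj raddfB. Qed.
HB.instance Definition _ :=
  GRing.isZmodMorphism.Build R (circle R) cproj cproj_is_zmod_morphism.

Lemma cproj_eq s t : (cproj s == cproj t) = (s - t \is a Num.int).
Proof.
by rewrite (_ : (s - t \is a Num.int) = (s - t \in int_subgroup R))//
  Quotient.idealrBE.
Qed.

Lemma crepK : cancel crep cproj.
Proof.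
move=> x; rewrite /crep -[RHS]reprK; apply/eqP.
rewrite [_ == _]cproj_eq addrAC subrr add0r rpredN.
exact: intr_int.
Qed.

Lemma crep_min (t : R) : `|crep (cproj t)| <= `|t|.
Proof.
have : cproj (crep (cproj t)) == cproj t by rewrite crepK.
rewrite cproj_eq => /intrP[m].
have : - 2^-1 <= crep (cproj t) < 2^-1.
  rewrite /crep /=; set s := repr _.
  have := floor_itv (s + 2^-1); rewrite intrD => /andP[H1 H2].
  by apply/andP; split; lra.
set c := crep _ => /andP[c1 c2] /eqP; rewrite subr_eq => /eqP cE.
have [m0|m0] := leP m 0; last first.
  have : 1 <= m%:~R :> R by rewrite (_ : 1 = 1%:~R)// ler_int.
  move=> m1; rewrite [leRHS]ltr0_norm; last lra.
  by rewrite ler_norml; apply/andP; split; lra.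
have [m00|mn0] := eqVneq m 0; first by rewrite cE m00 add0r.
have : m%:~R <= -1 :> R.
  rewrite (_ : -1 = (-1)%:~R)// ler_int.
  by move: m0 mn0; clear; case: m => [[|m]|[|m]].
move=> m1; rewrite [leRHS]ger0_norm; last lra.
by rewrite ler_norml; apply/andP; split; lra.
Qed.

Fact cdistxx x : cdist x x = 0.
Proof.
rewrite /cdist subrr; apply/eqP; rewrite eq_le normr_ge0 andbT.
by rewrite -(raddf0 cproj); apply: le_trans (crep_min 0) _; rewrite normr0.
Qed.

Fact cdist_positivity x y : cdist x y = 0 -> x = y.
Proof.
move=> /eqP; rewrite normr_eq0 => /eqP xy; apply/eqP; rewrite -subr_eq0.
by rewrite -(crepK (x - y)) xy raddf0.
Qed.

Fact cdist_sym x y : cdist x y = cdist y x.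
Proof.
suff H u v : cdist u v <= cdist v u by apply/eqP; rewrite eq_le !H.
rewrite /cdist -(opprB v u) -[v - u in leLHS]crepK -raddfN.
by apply: le_trans (crep_min _) _; rewrite normrN.
Qed.

Fact cdist_triangle y x z : cdist x z <= cdist x y + cdist y z.
Proof.
rewrite /cdist -(subrKA y) -[x - y in leLHS]crepK.
rewrite -[y - z in leLHS]crepK -raddfD.
exact: le_trans (crep_min _) (ler_normD _ _).
Qed.

HB.instance Definition _ := isMetric.Build R (circle R)
  cdistxx cdist_positivity cdist_sym cdist_triangle.

Definition borel_display : measure_display := sigma_display (@open (circle R)).

HB.instance Definition _ := @isMeasurable.Build borel_display (circle R)
  <<s @open (circle R) >> (@sigma_algebra0 _ setT _) (@sigma_algebraC _ _)
  (@sigma_algebra_bigcup _ setT _).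

End circle_metric.
Arguments cproj {R} t.

(* For V and W finite-dimensional, this is C^k: all iterated directional
   derivatives up to order k exist and are continuous. *)
Fixpoint cont_diff (R : realType) (V W : normedModType R) (k : nat)
    (f : V -> W) : Prop :=
  if k is k'.+1 then
    continuous f /\
    forall v, (forall x, derivable f x v) /\ cont_diff k' ('D_v f)
  else continuous f.

Section circle_calculus.
Variable R : realType.
Implicit Types (f : circle R -> circle R) (x : circle R).

(* A circle map read in the translation charts centred at x and f x. *)
Definition circle_chart f x (t : R) : R := crep (f (x + cproj t) - f x).

Definition circle_derivable f x : Prop := derivable (circle_chart f x) 0 1.

Definition circle_derive f x : R := derive1 (circle_chart f x) 0.

Definition circle_C2 f : Prop :=
  (forall x, circle_derivable f x) /\
  cont_diff 1 (fun t : R => circle_derive f (cproj t)).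

Definition torus_fun_C2 (h : circle R -> circle R -> R) : Prop :=
  cont_diff 2 (fun st : R * R => h (cproj st.1) (cproj st.2)).

End circle_calculus.

Section circle_measures.
Variable R : realType.

Definition M1 := probability (circle R) R.

(* The push-forward is only meant for measurable f; a non-measurable f is given
   the junk value mu. *)
Definition transfer (f : circle R -> circle R) (mu : M1) : M1 :=
  match pselect (f \in mfun) with
  | left mf => distribution mu (mfun_Sub mf)
  | right _ => mu
  end.

Definition msupport (mu : M1) : set (circle R) :=
  [set x | forall A : set (circle R), open A -> A x -> (0 < mu A)%E].

(* An arc may contain both, one or none of its endpoints. *)
Definition is_arc (I : set (circle R)) (l : R) : Prop :=
  exists (a : R) (bl br : bool), 0 <= l <= 1 /\
    I = cproj @` [set` Interval (BSide bl a) (BSide br (a + l))].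

Definition support_length (mu : M1) : R :=
  inf [set l | exists2 I, is_arc I l & msupport mu `<=` I].

Definition lip1 (phi : circle R -> R) : Prop :=
  forall x y, `|phi x - phi y| <= mdist x y.

Definition wasserstein (mu nu : M1) : \bar R :=
  ereal_sup
    [set (\int[mu]_x phi x - \int[nu]_x phi x)%:E | phi in [set phi | lip1 phi]].

Definition state (n : nat) := 'I_n -> M1.

Definition wasserstein_state n (mu nu : state n) : \bar R :=
  \big[maxe/-oo%E]_(i < n) wasserstein (mu i) (nu i).

Definition wasserstein_to n (mu : state n) (A : set (state n)) : \bar R :=
  ereal_inf [set wasserstein_state mu nu | nu in A].

Definition torus (n : nat) := 'rV[circle R]_n.

(* The max metric, which induces the topology of torus n. *)
Definition torus_dist n (x y : torus n) : R :=
  \big[Num.max/0]_(i < n) mdist (x 0 i) (y 0 i).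

Definition set_dist n (A B : set (torus n)) : \bar R :=
  ereal_inf [set (torus_dist xy.1 xy.2)%:E | xy in A `*` B].

Definition boundary (T : topologicalType) (A : set T) : set T :=
  closure A `\` interior A.

Definition diracs n (x : torus n) : state n := fun i => \d_(x 0 i).

Definition state_support n (nu : state n) : set (torus n) :=
  [set x | forall i, msupport (nu i) (x 0 i)].

Definition support_size n (nu : state n) : R :=
  \big[Num.max/0]_(i < n) support_length (nu i).

Definition small_support n (eps : R) (U : set (torus n)) : set (state n) :=
  [set nu | support_size nu < eps /\ state_support nu `<=` U].

End circle_measures.

Section self_consistent_operator.
Variables (R : realType) (N1 N2 : nat).
Local Notation N := (N1 + N2)%N.
Variables (f : 'I_N -> circle R -> circle R).
Variables (h : 'I_N -> 'I_N -> circle R -> circle R -> R).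

Definition Pi1 (eta : state R N) : state R N1 := fun i => eta (lshift N2 i).

Definition Pi2 (eta : state R N) : state R N2 := fun i => eta (rshift N1 i).

Definition join_state (mu : state R N1) (nu : state R N2) : state R N :=
  fun k => match fintype.split k with inl i => mu i | inr j => nu j end.

Definition Fmap (eta : state R N) (i : 'I_N) (x : circle R) : circle R :=
  f i (x + cproj (\sum_(j < N) \int[eta j]_y h i j x y)).

Definition Fop (eta : state R N) : state R N :=
  fun i => transfer (Fmap eta i) (eta i).

Definition Fop2 (mu : state R N1) (nu : state R N2) : state R N2 :=
  Pi2 (Fop (join_state mu nu)).

(* The unique x' such that Fop2 mu maps the Dirac masses at x to those at x'.
   Measures are compared on Borel sets only, since in Rocq they are functions
   on all sets. *)
Definition Gmap (mu : state R N1) (x : torus R N2) : torus R N2 :=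
  xget x [set x' | forall i A, measurable A ->
                     Fop2 mu (diracs x) i A = diracs x' i A].

Definition gder (mu : state R N1) (i : 'I_N2) (x : torus R N2) : R :=
  circle_derive (Fmap (join_state mu (diracs x)) (rshift N1 i)) (x 0 i).

Definition part_sync (U : set (torus R N2)) : set (state R N) :=
  [set join_state mu (diracs x) | mu in setT & x in U].

End self_consistent_operator.

(* Main.v *)
(* The diameters of the supports of the Group 2 measures contract. If the
   supports of nu have diameter at most D and p is a point of their product,
   then nu is D-close to the Dirac state at p. As f and h are C^2, the circle
   maps driven by (mu, nu) are C^1-close, with error C D, on the supports to
   those driven by (mu, delta_p), whose derivatives at p are at most lambda. By
   the mean value inequality along geodesics, the diameters of the image
   supports are at most (lambda + C D) D. The image supports also lie within
   C D of G_mu(p), which is in U and, unless C D > delta, too far from the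
   boundary of U for them to leave U. For eps with lambda + C eps < 1 and
   C eps <= delta this can be iterated, so the diameters decay geometrically,
   and they bound the Wasserstein distance to a Dirac state supported in U. *)
Require Import Defs.
From HB Require Import structures.
From mathcomp Require Import all_boot all_order all_algebra.
From mathcomp Require Import ring lra.
From mathcomp Require Import all_classical all_reals all_analysis.
From mathcomp Require Import measurable_realfun.

Set Implicit Arguments.
Unset Strict Implicit.
Unset Printing Implicit Defensive.

Import Order.TTheory GRing.Theory Num.Theory.
Import numFieldNormedType.Exports.

Local Open Scope classical_set_scope.
Local Open Scope ring_scope.

(** * Lifts and distances on the circle *)

Section circle_metric_facts.
Variable R : realType.
Implicit Types (x y z : circle R) (s t : R).

Lemma cprojD s t : cproj (s + t) = cproj s + cproj t.
Proof. exact: (raddfD (@cproj R)). Qed.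

Lemma cprojD_crep s t : cproj (s + crep (cproj t)) = cproj (s + t).
Proof. by rewrite cprojD crepK -cprojD. Qed.

Lemma cprojB s t : cproj (s - t) = cproj s - cproj t.
Proof. exact: (raddfB (@cproj R)). Qed.

Lemma cproj0 : cproj 0 = 0 :> circle R.
Proof. exact: (raddf0 (@cproj R)). Qed.

Lemma cprojD1 s : cproj (s + 1) = cproj s.
Proof. by apply/eqP; rewrite cproj_eq addrAC subrr add0r rpred1. Qed.

Lemma mdist_cproj s t : mdist (cproj s) (cproj t) <= `|s - t|.
Proof. by rewrite [mdist _ _]/(`|crep _|) -cprojB; exact: crep_min. Qed.

Lemma mdist_add x y s t :
  mdist (x + cproj s) (y + cproj t) <= mdist x y + `|s - t|.
Proof.
rewrite [mdist x y]/(`|crep (x - y)|); have := crepK (x - y).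
move: (crep _) => c cE.
have -> : mdist (x + cproj s) (y + cproj t) = `|crep (cproj (c + (s - t)))|.
  rewrite cprojD cprojB cE [mdist _ _]/(`|crep _|).
  by congr `|crep _|; rewrite opprD addrACA.
by apply: le_trans (crep_min _) _; exact: ler_normD.
Qed.

(** Lifts that realize the distance turn Lipschitz estimates on the circle into mean value estimates
    on the line. *)
Lemma circle_lift x y :
  exists s t, [/\ cproj s = x, cproj t = y & mdist x y = `|s - t|].
Proof.
exists (crep y + crep (x - y)), (crep y); split.
- by rewrite cprojD !crepK addrC subrK.
- exact: crepK.
- by rewrite addrAC subrr add0r.
Qed.

Lemma crep_bounds x : - 2^-1 <= crep x < 2^-1.
Proof.
rewrite /crep; set s := repr _.
have := floor_itv (s + 2^-1); rewrite intrD => /andP[H1 H2].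
by apply/andP; split; lra.
Qed.

Lemma crep_norm_le1 x : `|crep x| <= 1.
Proof.
by have /andP[? ?] := crep_bounds x; rewrite ler_norml; apply/andP; split; lra.
Qed.

Lemma mdist_circle_le1 x y : mdist x y <= 1.
Proof. exact: crep_norm_le1. Qed.

End circle_metric_facts.

(* The supremum of the times up to which the estimate holds with a slightly
   larger constant belongs to them, and cannot be smaller than b. *)
Lemma mdist_mean_value (R : realType) (T : metricType R) (phi : R -> T)
    (K a b : R) : a <= b -> 0 <= K ->
  (forall t, a <= t <= b -> forall L, K < L ->
     \forall s \near t, mdist (phi s) (phi t) <= L * `|s - t|) ->
  mdist (phi b) (phi a) <= K * (b - a).
Proof.
move=> ab K0 loc.
suff H L : K < L -> mdist (phi b) (phi a) <= L * (b - a).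
  apply/ler_addgt0Pr => e e0.
  (* The added 1 keeps the denominator positive when [a = b]. *)
  have d0 : 0 < b - a + 1 by lra.
  have /H/le_trans -> // : K < K + e / (b - a + 1) by rewrite ltrDl divr_gt0.
  rewrite mulrDl lerD2l -mulrA ger_pMr// mulrC ler_pdivrMr//; lra.
move=> KL; have L0 : 0 < L by lra.
pose A := [set t | a <= t <= b /\ mdist (phi t) (phi a) <= L * (t - a)].
have Aa : A a by split; rewrite ?lexx ?ab// mdistxx subrr mulr0.
have ubA : has_ubound A by exists b => t [/andP[]].
have supA : has_sup A by split => //; exists a.
set c := sup A.
have ac : a <= c by exact: ub_le_sup.
have cb : c <= b by apply: ge_sup; [exists a|move=> t [/andP[]]].
have /nbhs_ballP[e /= e0 ce] : \forall s \near c,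
    mdist (phi s) (phi c) <= L * `|s - c| by apply: loc; rewrite ?ac.
have Ac : mdist (phi c) (phi a) <= L * (c - a).
  have [t [/andP[at_ tb] At] ct] := sup_adherent e0 supA.
  have tc : t <= c by apply: ub_le_sup => //; split; rewrite ?at_.
  have {}ce : mdist (phi t) (phi c) <= L * `|t - c|.
    apply: ce; rewrite /ball /= ger0_norm ?subr_ge0//; rewrite -/c in ct; lra.
  apply: le_trans (metric_triangle _ (phi t) _) _.
  rewrite metric_sym; move: ce; rewrite distrC ger0_norm ?subr_ge0// => ce.
  have -> : c - a = (c - t) + (t - a) by lra.
  by rewrite mulrDr lerD.
have [cb'|] := ltP c b; last first.
  by move=> bc; have -> : b = c by apply/eqP; rewrite eq_le bc cb.
pose t := Num.min b (c + e / 2).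
have ct : c < t by rewrite lt_min cb'/= ltrDl divr_gt0.
have te : t <= c + e / 2 by rewrite ge_min lexx orbT.
have tb : t <= b by rewrite ge_min lexx.
suff /(ub_le_sup ubA) : A t by rewrite leNgt ct.
split; first by rewrite tb (le_trans ac)// ltW.
have {}ce : mdist (phi t) (phi c) <= L * `|t - c|.
  by apply: ce; rewrite /ball /= distrC gtr0_norm; lra.
apply: le_trans (metric_triangle _ (phi c) _) _.
move: ce; rewrite gtr0_norm ?subr_gt0// => ce.
have -> : t - a = (t - c) + (c - a) by lra.
by rewrite mulrDr lerD.
Qed.

(** * Borel sets, supports, integrals and Wasserstein distance on the circle *)

Section circle_measurability.
Variable R : realType.
Implicit Types (x y : circle R) (phi : circle R -> R) (K : R).

(** Interiors of balls serve below as open, hence measurable, sets; by the triangle inequality they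
    lose no point of the ball. *)
Lemma interior_ball_circle x y (e : R) : mdist x y < e -> (ball x e)° y.
Proof.
move=> xy; apply/nbhs_ballP; exists (e - mdist x y).
  by rewrite /= subr_gt0.
move=> z; rewrite !ballEmdist /= ltrBrDl => yz.
exact: le_lt_trans (metric_triangle _ y _) yz.
Qed.

Lemma circle_open_measurable (A : set (circle R)) : open A -> measurable A.
Proof. by move=> oA; exact: sub_sigma_algebra. Qed.

Lemma continuous_circle_measurable (f : circle R -> circle R) :
  continuous f -> measurable_fun setT f.
Proof.
move=> /continuousP cf; apply: (measurability (@open (circle R))) => //.
move=> _ [A oA <-]; rewrite setTI.
by apply: circle_open_measurable; exact: cf.
Qed.

Lemma continuous_circle_measurable_real phi :
  continuous phi -> measurable_fun setT phi.
Proof.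
move=> /continuousP cf.
apply: (measurability _ (RGenOpens.measurableE R)).
move=> _ [_ [a [b ->]] <-]; rewrite setTI.
by apply: circle_open_measurable; apply: cf; exact: interval_open.
Qed.

(** The interior of the ball around [x] of radius [mdist x y] contains [x] but not [y], so it would
    tell the two masses apart. *)
Lemma dirac_circle_inj x y :
  (forall A : set (circle R), measurable A -> \d_x A = \d_y A :> \bar R) ->
  x = y.
Proof.
move=> xy; apply: contrapT => /eqP neq.
pose A := (ball x (mdist x y))°.
have Ax : A x.
  by apply: nbhsx_ballx; rewrite mdist_gt0.
have nAy : ~ A y.
  by move=> /interior_subset; rewrite ballEmdist /= ltxx.
have /xy : measurable A by apply: circle_open_measurable; exact: open_interior.
rewrite !diracE (mem_set Ax) (memNset nAy) => -[] /eqP.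
by rewrite oner_eq0.
Qed.

Lemma lipschitz_circle_continuous phi K :
  (forall x y, `|phi x - phi y| <= K * mdist x y) -> continuous phi.
Proof.
move=> lip x; apply/(@cvgrPdist_le _ _ _ (nbhs x) (nbhs_filter x)) => e e0.
(* No sign is assumed for [K], so a positive constant above it is used. *)
have K1 : 0 < `|K| + 1 by rewrite ltr_wpDl.
have d0 : 0 < e / (`|K| + 1) by rewrite divr_gt0.
apply: (@filterS _ _ (nbhs_filter x) _ _ _ (nbhsx_ballx x _ d0)) => y.
rewrite ballEmdist /= ltr_pdivlMr// => xy; apply: le_trans (lip _ _) _.
apply: le_trans (ltW xy); rewrite mulrC ler_wpM2l ?mdist_ge0//.
by rewrite (le_trans (ler_norm K))// lerDl.
Qed.

Section integration.
Variable mu : M1 R.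

(** Distances on the circle are at most 1, so [phi] is bounded by |phi(0)| + |K|, and [mu] is
    finite. *)
Lemma lipschitz_circle_integrable phi K :
  (forall x y, `|phi x - phi y| <= K * mdist x y) ->
  mu.-integrable setT (EFin \o phi).
Proof.
move=> lip.
have mphi : measurable_fun setT phi.
  apply: continuous_circle_measurable_real.
  exact: lipschitz_circle_continuous lip.
apply: measurable_bounded_integrable => //; first exact: fin_num_fun_lty.
exists (`|phi 0| + `|K|); split; first exact: num_real.
move=> M /ltW MK x _ /=; apply: le_trans MK.
rewrite -[phi x](subrK (phi 0)) addrC (le_trans (ler_normD _ _))// lerD2l.
apply: le_trans (lip _ _) _.
apply: (@le_trans _ _ (`|K| * mdist x 0)).
  by rewrite ler_wpM2r ?mdist_ge0// ler_norm.
by rewrite ler_piMr// mdist_circle_le1.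
Qed.

(* The complement of the support is covered by null balls of radius 1/(n+1)
   centred at the points k/(n+1). *)
Lemma ae_msupport : {ae mu, forall x, msupport mu x}.
Proof.
pose B (n k : nat) : set (circle R) :=
  (ball (cproj (k%:R / n.+1%:R)) (n.+1%:R^-1))°.
pose N := \bigcup_n \bigcup_k (if mu (B n k) == 0%E then B n k else set0).
have mB n k : measurable (B n k).
  by apply: circle_open_measurable; exact: open_interior.
have : mu.-negligible N.
  apply: negligible_bigcup => n; apply: negligible_bigcup => k.
  case: ifPn => [/eqP B0|_]; last exact: negligible_set0.
  by exists (B n k); split.
apply: negligibleS => x /= /existsNP[A /not_implyP[oA /not_implyP[Ax A0]]].
have {}A0 : mu A = 0%E.
  by apply/eqP; rewrite eq_le measure_ge0 andbT leNgt; apply/negP.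
have /nbhs_ballP[e /= e0 xeA] : nbhs x A by exact: open_nbhs_nbhs.
have [n ne] : exists n, n.+1%:R^-1 < e / 2.
  have := near_infty_natSinv_lt (PosNum (divr_gt0 e0 (ltr0n R 2))).
  by move=> [n _ /(_ n (leqnn n))] /= nH; exists n.
have [k kx] : exists k : nat, mdist (cproj (k%:R / n.+1%:R)) x < n.+1%:R^-1.
  (* The shift by 1 gives a nonnegative lift of [x], so that truncation yields a natural number [k]
     with k / (n + 1) less than 1 / (n + 1) below it. *)
  pose t := crep x + 1; pose k := Num.trunc (t * n.+1%:R).
  exists k.
  have -> : x = cproj t.
    by rewrite cprojD1 crepK.
  have t0 : 0 <= t * n.+1%:R.
    rewrite mulr_ge0// /t; have := crep_norm_le1 x.
    by rewrite ler_norml => /andP[]; lra.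
  have /andP[kt tk] := truncn_itv t0.
  apply: le_lt_trans (mdist_cproj _ _) _.
  have n0 : 0 < n.+1%:R :> R by [].
  rewrite -(ltr_pM2r n0) mulVf ?gt_eqF// -[X in _ * X]gtr0_norm// -normrM.
  rewrite mulrBl divfK ?gt_eqF// distrC ger0_norm ?subr_ge0//.
  by rewrite ltrBlDl natr1.
exists n => //; exists k => //.
have BA : B n k `<=` A.
  move=> y /interior_subset yB; apply: xeA.
  move: yB kx; rewrite !ballEmdist /= => yB kx.
  apply: le_lt_trans (metric_triangle _ (cproj (k%:R / n.+1%:R)) _) _.
  rewrite metric_sym (lt_trans (ltrD kx yB))// [e in ltRHS]splitr.
  exact: ltrD.
have -> : mu (B n k) == 0%E.
  rewrite eq_le measure_ge0 andbT -A0 le_measure// inE//.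
  exact: circle_open_measurable.
exact: interior_ball_circle.
Qed.

Lemma msupport_meets (A : set (circle R)) :
  measurable A -> (0 < mu A)%E -> exists2 x, msupport mu x & A x.
Proof.
move=> mA A0; apply: contrapT => noA.
suff : mu.-negligible A.
  by move=> /(negligibleP _ mA) /eqP; rewrite gt_eqF.
apply: negligibleS ae_msupport => x Ax sx; apply: noA.
by exists x; [exact: sx|exact: Ax].
Qed.

Lemma msupport_neq0 : exists x, msupport mu x.
Proof.
have [|x sx _] := @msupport_meets setT measurableT; last by exists x.
by rewrite probability_setT lte01.
Qed.

(** The support carries all the mass, so the bound holds almost everywhere, and [mu] has mass 1; the
    Lipschitz condition gives integrability. Most integral estimates below reduce to this one. *)
Lemma Rintegral_near_cst phi (K c D : R) :
  (forall x y, `|phi x - phi y| <= K * mdist x y) ->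
  (forall y, msupport mu y -> `|phi y - c| <= D) ->
  `|\int[mu]_x phi x - c| <= D.
Proof.
move=> lip suppD.
have iphi := lipschitz_circle_integrable lip.
have lipc x y : `|(phi x - c) - (phi y - c)| <= K * mdist x y.
  by rewrite opprB addrA subrK.
have iphic := lipschitz_circle_integrable lipc.
have cE : c = \int[mu]_x (cst c x).
  transitivity (c * fine (mu setT)); first by rewrite probability_setT mulr1.
  by rewrite Rintegral_cst.
have ic : mu.-integrable setT (EFin \o cst c).
  apply: (@lipschitz_circle_integrable _ 0) => x y.
  by rewrite subrr normr0 mul0r.
have -> : \int[mu]_x phi x - c = \int[mu]_x (phi x - c).
  by rewrite {1}cE -RintegralB.
rewrite -lee_fin EFin_normr_Rintegral//.
apply: le_trans (le_abse_integral _ _ _) _ => //.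
  by case/integrableP : iphic.
(* The support is nonempty, which forces the sign of [D]. *)
have D0 : 0 <= D by have [x /suppD] := msupport_neq0; exact: le_trans.
have -> : D%:E = (\int[mu]_x (cst D%:E x))%E.
  transitivity (D%:E * mu setT)%E; first by rewrite probability_setT mule1.
  by rewrite integral_cst.
apply: ae_ge0_le_integral => //.
  by apply: measurableT_comp => //; case/integrableP : iphic.
by apply: filterS ae_msupport => x sx _; rewrite /= lee_fin suppD.
Qed.

(** Continuity rules out the default value that [transfer] takes on non-measurable maps. *)
Lemma transferE (F : circle R -> circle R) (A : set (circle R)) :
  continuous F -> transfer F mu A = mu (F @^-1` A).
Proof.
move=> cF; rewrite /transfer; case: pselect => //= mF; exfalso; apply: mF.
by rewrite inE /=; exact: continuous_circle_measurable.
Qed.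

(** The preimage of a small open neighbourhood of [y] has positive mass, so it meets the support of
    [mu]. The margin [e] spares a proof that the image of the support is closed. *)
Lemma msupport_transfer (F : circle R -> circle R) y (e : R) :
  continuous F -> msupport (transfer F mu) y -> 0 < e ->
  exists2 x, msupport mu x & mdist y (F x) < e.
Proof.
move=> cF sy e0; pose A := (ball y e)°.
have oA : open A by exact: open_interior.
have Ay : A y by exact: nbhsx_ballx.
have [||x sx /interior_subset] := @msupport_meets (F @^-1` A).
- rewrite -[_ @^-1` _]setTI; apply: continuous_circle_measurable => //.
  exact: circle_open_measurable.
- by rewrite -transferE//; exact: sy.
- by rewrite ballEmdist /= => yx; exists x.
Qed.

End integration.

Lemma msupport_dirac x y : msupport (\d_x : M1 R) y -> y = x.
Proof.
move=> sy; apply: contrapT => /eqP neq; pose A := (ball y (mdist y x))°.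
have oA : open A by exact: open_interior.
have Ay : A y by apply: nbhsx_ballx; rewrite mdist_gt0.
have := sy _ oA Ay; rewrite /= diracE memNset ?ltxx//.
by move=> /interior_subset; rewrite ballEmdist /= ltxx.
Qed.

(** This is the estimate near a constant with error 0, the support being a single point. *)
Lemma Rintegral_dirac phi K x :
  (forall x y, `|phi x - phi y| <= K * mdist x y) ->
  \int[(\d_x : M1 R)]_y phi y = phi x.
Proof.
move=> lip; apply/eqP; rewrite -subr_eq0 -normr_le0.
apply: (Rintegral_near_cst lip) => y /msupport_dirac ->.
by rewrite subrr normr0.
Qed.

Lemma wasserstein_ge0 (mu nu : M1 R) : (0 <= wasserstein mu nu)%E.
Proof.
apply: ereal_sup_ubound; exists (cst 0); last first.
  by rewrite !Rintegral_cst// !mul0r subrr.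
by move=> x y; rewrite subrr normr0 mdist_ge0.
Qed.

Lemma wasserstein_dirac_le (mu : M1 R) x D :
  (forall y, msupport mu y -> mdist y x <= D) ->
  (wasserstein mu \d_x <= D%:E)%E.
Proof.
move=> suppD; apply: ge_ereal_sup => _ [phi lip <-].
have {}lip u v : `|phi u - phi v| <= 1 * mdist u v by rewrite mul1r; exact: lip.
rewrite lee_fin (Rintegral_dirac _ lip) (le_trans (ler_norm _))//.
apply: (Rintegral_near_cst lip) => y /suppD; apply: le_trans.
by rewrite -[leRHS]mul1r; exact: lip.
Qed.

End circle_measurability.

(** * Bounds and Lipschitz constants for periodic functions *)

Section circle_calculus_facts.
Variable R : realType.
Implicit Types (x y z : circle R) (s t : R).

(** The position of [c] is recorded as a distance to [t], so that one statement covers both orders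
    of [s] and [t]. *)
Lemma mean_value (g : R -> R) s t : (forall r, derivable g r 1) ->
  exists2 c, `|c - t| <= `|s - t| & g s - g t = 'D_1 g c * (s - t).
Proof.
move=> dg; have gdg (r : R) : is_derive r 1 g ('D_1 g r) by exact: derivableP.
have cg a b : {within `[a, b], continuous g}.
  apply: continuous_subspaceT => r; apply: differentiable_continuous.
  exact/derivable1_diffP.
have [ts|/ltW st] := leP t s.
  have [c /[!in_itv]/= /andP[tc cs] ->] :=
    @MVT_segment R g _ t s ts (fun r _ => gdg r) (cg _ _).
  by exists c => //; rewrite !ger0_norm; lra.
have [c /[!in_itv]/= /andP[sc ct] E] :=
  @MVT_segment R g _ s t st (fun r _ => gdg r) (cg _ _).
exists c; first by rewrite !ler0_norm; lra.
by rewrite -[g s - g t]opprB E -mulrN opprB.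
Qed.

Lemma mean_value_norm (g : R -> R) K : (forall t, derivable g t 1) ->
  (forall t, `|'D_1 g t| <= K) -> forall s t, `|g s - g t| <= K * `|s - t|.
Proof.
move=> dg gK s t; have [c _ ->] := mean_value s t dg.
by rewrite normrM ler_wpM2r.
Qed.

(** Every pair of circle points has a lift in the compact square of side [-1, 1]. *)
Lemma periodic2_bounded (k : circle R -> circle R -> R) :
  continuous (fun st : R * R => k (cproj st.1) (cproj st.2)) ->
  exists2 K, 0 <= K & forall x y, `|k x y| <= K.
Proof.
set g := fun st : R * R => _ => cg.
pose I := `[(-1 : R), 1]%classic.
have cI : compact (g @` (I `*` I)).
  apply: continuous_compact; first exact: continuous_subspaceT.
  by apply: compact_setX; exact: segment_compact.
have [M [_ gM]] := compact_bounded cI.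
exists (`|M| + 1) => [|x y]; first by rewrite addr_ge0.
have := gM (`|M| + 1); apply; first by rewrite ltr_pwDr// ler_norm.
exists (crep x, crep y); last by rewrite /g /= !crepK.
split; rewrite /I /= in_itv /=.
  by have := crep_norm_le1 x; rewrite ler_norml.
by have := crep_norm_le1 y; rewrite ler_norml.
Qed.

Lemma periodic_bounded (k : circle R -> R) :
  continuous (fun t : R => k (cproj t)) ->
  exists2 K, 0 <= K & forall x, `|k x| <= K.
Proof.
move=> ck; have [|K K0 kK] := @periodic2_bounded (fun x _ => k x).
  move=> st; apply: (continuous_comp _ (ck _)); exact: cvg_fst.
by exists K => // x; exact: kK x.
Qed.

(** A directional derivative depends only on the restriction to a line. This gives both the
    periodicity of derivatives and the passage to partial derivatives. *)
Lemma derive_line (V V' W : normedModType R) (f : V -> W) (f' : V' -> W)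
    (x v : V) (x' v' : V') :
  (forall r : R, f (r *: v + x) = f' (r *: v' + x')) ->
  (derivable f x v -> derivable f' x' v') /\ 'D_v f x = 'D_v' f' x'.
Proof.
move=> ff'; have xx' : f x = f' x'.
  by have := ff' 0; rewrite !scale0r !add0r.
have E : (fun h : R => h^-1 *: ((f \o shift x) (h *: v) - f x)) =
    (fun h => h^-1 *: ((f' \o shift x') (h *: v') - f' x')).
  by apply/funext => r /=; rewrite /shift /= ff' xx'.
by rewrite /derivable /derive E.
Qed.

Lemma derive_periodic2 (k : circle R -> circle R -> R) v s t :
  let g := fun st : R * R => k (cproj st.1) (cproj st.2) in
  'D_v g (s, t) = 'D_v g (crep (cproj s), crep (cproj t)).
Proof.
move=> g; apply: (derive_line _).2 => r.
by rewrite /g /= !cprojD_crep.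
Qed.

Lemma derive_fst (g : R * R -> R) s t :
  (derivable g (s, t) (1, 0) -> derivable (fun r => g (r, t)) s 1) /\
  'D_(1, 0) g (s, t) = 'D_1 (fun r => g (r, t)) s.
Proof.
by apply: derive_line => r; congr g;
  rewrite [LHS]surjective_pairing /= scaler0 add0r.
Qed.

Lemma derive_snd (g : R * R -> R) s t :
  (derivable g (s, t) (0, 1) -> derivable (fun r => g (s, r)) t 1) /\
  'D_(0, 1) g (s, t) = 'D_1 (fun r => g (s, r)) t.
Proof.
by apply: derive_line => r; congr g;
  rewrite [LHS]surjective_pairing /= scaler0 add0r.
Qed.

(** The partial derivatives are continuous and periodic, hence bounded; the mean value theorem is
    then applied to one variable at a time. *)
Lemma cont_diff1_torus_lipschitz (k : circle R -> circle R -> R) :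
  cont_diff 1 (fun st : R * R => k (cproj st.1) (cproj st.2)) ->
  exists2 K, 0 <= K & forall x x' y y',
    `|k x y - k x' y'| <= K * (mdist x x' + mdist y y').
Proof.
set g := fun st : R * R => _ => -[_ dg].
have bdd v : exists2 K, 0 <= K & forall s t, `|'D_v g (s, t)| <= K.
  have [|K K0 gK] := @periodic2_bounded (fun x y => 'D_v g (crep x, crep y)).
    rewrite (_ : (fun _ => _) = 'D_v g); first by have [] := dg v.
    by apply/funext => -[s t]; rewrite [RHS]derive_periodic2.
  by exists K => // s t; rewrite derive_periodic2.
have [K1 K10 gK1] := bdd (1, 0); have [K2 K20 gK2] := bdd (0, 1).
exists (K1 + K2) => [|x x' y y']; first exact: addr_ge0.
have [s [s' [<- <- ->]]] := circle_lift x x'.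
have [t [t' [<- <- ->]]] := circle_lift y y'.
rewrite -(subrKA (k (cproj s') (cproj t))) (le_trans (ler_normD _ _))//.
have H1 : `|g (s, t) - g (s', t)| <= K1 * `|s - s'|.
  apply: (mean_value_norm (g := fun r => g (r, t))) => r.
    by apply: (derive_fst _ _ _).1; have [] := dg (1, 0).
  by rewrite -(derive_fst _ _ _).2.
have H2 : `|g (s', t) - g (s', t')| <= K2 * `|t - t'|.
  apply: (mean_value_norm (g := fun r => g (s', r))) => r.
    by apply: (derive_snd _ _ _).1; have [] := dg (0, 1).
  by rewrite -(derive_snd _ _ _).2.
apply: le_trans (lerD H1 H2) _.
by rewrite mulrDr lerD// ler_wpM2r// ?lerDl ?lerDr.
Qed.

Lemma cont_diff1_circle_lipschitz (k : circle R -> R) :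
  cont_diff 1 (fun t : R => k (cproj t)) ->
  exists2 K, 0 <= K & forall x y, `|k x - k y| <= K * mdist x y.
Proof.
move=> [_ /(_ 1)[dk ck]].
have per s : 'D_1 (fun t : R => k (cproj t)) s =
    'D_1 (fun t : R => k (cproj t)) (crep (cproj s)).
  by apply: (derive_line _).2 => r; rewrite !cprojD_crep.
have [|K K0 kK] :=
    @periodic_bounded (fun x => 'D_1 (fun t : R => k (cproj t)) (crep x)).
  rewrite (_ : (fun _ => _) = 'D_1 (fun t : R => k (cproj t)))//.
  by apply/funext => s; rewrite [RHS]per.
exists K => // x y; have [s [t [<- <- ->]]] := circle_lift x y.
by apply: (mean_value_norm (g := fun t => k (cproj t))) => // r; rewrite per.
Qed.

End circle_calculus_facts.

(** * Derivatives of circle maps and of integrals depending on a parameter *)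

Section circle_differentiation.
Variable R : realType.
Implicit Types (f : circle R -> circle R) (x y z : circle R) (s t L : R).

Lemma circle_chart0 f x : circle_chart f x 0 = 0.
Proof.
rewrite /circle_chart cproj0 addr0; apply/eqP; rewrite -normr_eq0.
by apply/eqP; exact: (mdistxx (f x)).
Qed.

(** The distance is the absolute value of the chart at [s], and the chart vanishes at 0, so the
    bound on the limit of difference quotients passes to nearby [s]. *)
Lemma circle_derive_near f x L : circle_derivable f x ->
  `|circle_derive f x| < L ->
  \forall s \near 0, mdist (f (x + cproj s)) (f x) <= L * `|s|.
Proof.
move=> df; rewrite /circle_derive derive1E => /(cvgr_norm_lt _ df) fL.
near=> s; have [->|s0] := eqVneq s 0.
  by rewrite cproj0 addr0 mdistxx normr0 mulr0.
have : s != 0 -> `|s^-1 *: ((circle_chart f x \o shift 0) s%:A -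
    circle_chart f x 0)| < L.
  by near: s; move: fL; rewrite near_withinE.
move=> /(_ s0); rewrite circle_chart0 subr0 /shift /= addr0 [_%:A]mulr1.
rewrite normrM normfV mulrC ltr_pdivrMr ?normr_gt0// => /ltW.
exact: le_trans.
Unshelve. all: by end_near. Qed.

Lemma circle_derivable_continuous f :
  (forall x, circle_derivable f x) -> continuous f.
Proof.
move=> df x.
apply/(@metricType_numDomainType.cvgrPdist_lt _ _ _ (nbhs x) (nbhs_filter x)).
move=> e e0; pose L := `|circle_derive f x| + 1.
have L0 : 0 < L by rewrite ltr_wpDl.
have /nbhs_ballP[d /= d0 dL] : \forall s \near 0,
    mdist (f (x + cproj s)) (f x) <= L * `|s|.
  by apply: circle_derive_near; rewrite ?ltrDl.
have de0 : 0 < Num.min d (e / L) by rewrite lt_min d0 divr_gt0.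
apply: (@filterS _ _ (nbhs_filter x) _ _ _ (nbhsx_ballx x _ de0)) => y.
rewrite ballEmdist /= metric_sym lt_min => /andP[yd ye].
have yE : y = x + cproj (crep (y - x)) by rewrite crepK addrC subrK.
rewrite metric_sym {1}yE; apply: le_lt_trans (dL _ _) _.
  by rewrite /ball /= sub0r normrN.
by rewrite mulrC -ltr_pdivlMr.
Qed.

(* The derivative is only needed along the geodesic from x to y. *)
Lemma circle_mean_value f x y L : 0 <= L ->
  (forall z, circle_derivable f z) ->
  (forall z, mdist z x <= mdist y x -> `|circle_derive f z| <= L) ->
  mdist (f y) (f x) <= L * mdist y x.
Proof.
move=> L0 df fL; have [->|yx] := eqVneq y x; first by rewrite !mdistxx mulr0.
have c0 : 0 < mdist y x by rewrite mdist_gt0.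
have yE : y = x + cproj (1 * crep (y - x)).
  by rewrite mul1r crepK addrC subrK.
have xE : x = x + cproj (0 * crep (y - x)) by rewrite mul0r cproj0 addr0.
have cE : mdist y x = `|crep (y - x)| by [].
move: (crep _) yE xE cE => c yE xE cE.
(* The image under [f] of the geodesic from [x] at time 0 to [y] at time 1, whose constant speed is
   |c| = [mdist y x]. *)
pose phi t := f (x + cproj (t * c)).
suff : mdist (phi 1) (phi 0) <= L * mdist y x * (1 - 0).
  by rewrite /phi -yE -xE subr0 mulr1.
apply: mdist_mean_value; [exact: ler01|exact: mulr_ge0 (ltW c0)|].
move=> t /andP[t0 t1] M LM.
have zL : `|circle_derive f (x + cproj (t * c))| < M / mdist y x.
  rewrite ltr_pdivlMr//; apply: le_lt_trans LM; rewrite ler_wpM2r ?mdist_ge0//.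
  apply: fL; rewrite -[X in mdist _ X]addr0 -cproj0.
  apply: le_trans (mdist_add _ _ _ _) _.
  by rewrite mdistxx add0r subr0 normrM cE ler_piMl// ger0_norm.
have /nbhs_ballP[d /= d0 dL] := circle_derive_near (df _) zL.
apply/nbhs_ballP; exists (d / mdist y x); first by rewrite /= divr_gt0.
move=> s; rewrite /ball /= ltr_pdivlMr// => st.
have := dL ((s - t) * c).
rewrite -addrA -cprojD -mulrDl addrCA subrr addr0 normrM -cE mulrCA.
rewrite divfK ?gt_eqF//; rewrite -/(phi s) -/(phi t).
have -> : `|s - t| * M = M * `|s - t| by rewrite mulrC.
apply; rewrite /ball /= sub0r normrN normrM -cE distrC.
exact: st.
Qed.

(** In charts [F] is the chart of [f] at x + H(x) composed with the real function u(s) = s + H(x +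
    s) - H(x), whose derivative at 0 is 1 + dH. *)
Lemma is_circle_derive_comp f (H : circle R -> R) x dH :
  circle_derivable f (x + cproj (H x)) ->
  is_derive (0 : R) 1 (fun s => H (x + cproj s)) dH ->
  let F := fun z => f (z + cproj (H z)) in
  circle_derivable F x /\
  circle_derive F x = circle_derive f (x + cproj (H x)) * (1 + dH).
Proof.
move=> df HdH F; pose a := x + cproj (H x).
pose u s : R := s + (H (x + cproj s) - H x).
have chartE : circle_chart F x = circle_chart f a \o u.
  apply/funext => s; rewrite /circle_chart /F /= /u /a.
  congr crep; congr (f _ - _).
  rewrite cprojD cprojB -!addrA; congr (_ + _); rewrite [RHS]addrCA.
  by congr (_ + _); rewrite addrCA subrr addr0.
have u0 : u 0 = 0 by rewrite /u cproj0 addr0 subrr addr0.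
have udu : is_derive (0 : R) 1 u (1 + dH).
  rewrite -[dH]subr0; apply: is_deriveD; apply: is_deriveB.
have fdf : is_derive (u 0) 1 (circle_chart f a) (circle_derive f a).
  by rewrite u0 /circle_derive derive1E; exact: derivableP.
have := is_derive1_comp fdf udu; rewrite -chartE => FdF.
split; first by case: FdF.
by rewrite /circle_derive derive1E; case: FdF.
Qed.

(** The difference quotient differs from [d] by at most K |s|. *)
Lemma is_derive_quadratic (g : R -> R) (d K : R) :
  (forall s, `|g s - g 0 - s * d| <= K * s ^+ 2) -> is_derive (0 : R) 1 g d.
Proof.
move=> gK.
suff gd : h^-1 *: ((g \o shift 0) h%:A - g 0) @[h --> (0 : R)^'] --> d.
  by split; [exact: cvgP gd|exact: cvg_lim gd].
apply/subr_cvg0; apply: (@cvg_to_0_linear _ _ K 1) => // s /andP[s0 _].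
rewrite /shift /= addr0 [s%:A]mulr1.
have s0' : s != 0 by rewrite -normr_gt0.
have -> : s^-1 *: (g s - g 0) - d = s^-1 * (g s - g 0 - s * d).
  by rewrite mulrBr mulKf.
rewrite normrM normfV mulrC ler_pdivrMr// -mulrA -expr2 real_normK ?num_real//.
Qed.

(** The partial derivative in the first variable. By periodicity the choice of representatives is
    harmless, and it makes this a function of circle points. *)
Definition torus_dx (k : circle R -> circle R -> R) x y : R :=
  'D_(1, 0) (fun st : R * R => k (cproj st.1) (cproj st.2)) (crep x, crep y).

(** Both [k] and [torus_dx k] are C^1, hence Lipschitz. The last bound is a Taylor remainder: by the
    mean value theorem it is [s] times a variation of [torus_dx k] over a distance at most |s|. *)
Lemma torus_C2_bounds (k : circle R -> circle R -> R) : torus_fun_C2 k ->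
  exists2 K, 0 <= K & [/\
    (forall x x' y y', `|k x y - k x' y'| <= K * (mdist x x' + mdist y y')),
    (forall x x' y y', `|torus_dx k x y - torus_dx k x' y'| <=
       K * (mdist x x' + mdist y y')),
    (forall x y, `|torus_dx k x y| <= K) &
    (forall x y s, `|k (x + cproj s) y - k x y - s * torus_dx k x y| <=
       K * s ^+ 2)].
Proof.
move=> [ck dk].
have [|K1 K10 kK1] := @cont_diff1_torus_lipschitz R k.
  by split => // v; have [dkv [cdkv _]] := dk v.
have dxE : (fun st : R * R => torus_dx k (cproj st.1) (cproj st.2)) =
    'D_(1, 0) (fun st : R * R => k (cproj st.1) (cproj st.2)).
  by apply/funext => -[s t]; rewrite /torus_dx /= -derive_periodic2.
have [dkx cdx] := dk (1, 0).
have [|K2 K20 kK2] := @cont_diff1_torus_lipschitz R (torus_dx k).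
  by rewrite dxE.
have [|K3 K30 kK3] := @periodic2_bounded R (torus_dx k).
  by rewrite dxE; case: cdx.
exists (K1 + K2 + K3); first by rewrite !addr_ge0.
have KK1 : K1 <= K1 + K2 + K3 by rewrite -addrA lerDl addr_ge0.
have KK2 : K2 <= K1 + K2 + K3 by rewrite addrAC lerDr addr_ge0.
have KK3 : K3 <= K1 + K2 + K3 by rewrite lerDr addr_ge0.
split.
- move=> x x' y y'; apply: le_trans (kK1 _ _ _ _) _.
  by rewrite ler_wpM2r// addr_ge0 ?mdist_ge0.
- move=> x x' y y'; apply: le_trans (kK2 _ _ _ _) _.
  by rewrite ler_wpM2r// addr_ge0 ?mdist_ge0.
- by move=> x y; exact: le_trans (kK3 _ _) KK3.
- move=> x y s; apply: (@le_trans _ _ (K2 * s ^+ 2)); last first.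
    by rewrite ler_wpM2r// sqr_ge0.
  pose g (r : R) := k (cproj r) y.
  have gdg (r : R) : derivable g r 1 /\ 'D_1 g r = torus_dx k (cproj r) y.
    pose G (st : R * R) := k (cproj st.1) (cproj st.2).
    have -> : g = fun r => G (r, crep y).
      by apply/funext => r'; rewrite /g /G /= crepK.
    have [dG <-] := derive_fst G r (crep y).
    by split; [exact: dG|rewrite /G derive_periodic2 /torus_dx crepK].
  have [r <-] : exists r, cproj r = x by exists (crep x); exact: crepK.
  have [|c cs gc] := @mean_value R g (r + s) r.
    by move=> c; have [] := gdg c.
  rewrite -cprojD -[k (cproj (r + s)) y]/(g (r + s)) -[k (cproj r) y]/(g r) gc.
  rewrite (gdg c).2 (_ : r + s - r = s) in cs *; last first.
    by rewrite addrAC subrr add0r.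
  rewrite mulrC -mulrBr normrM expr2.
  rewrite -[s * s]ger0_norm ?sqr_ge0// normrM mulrCA ler_wpM2l//.
  apply: le_trans (kK2 _ _ _ _) _; rewrite ler_wpM2l//.
  by rewrite mdistxx addr0 (le_trans (mdist_cproj _ _)).
Qed.

(** Differentiation under the integral: the quadratic remainder bound is uniform in [y], so it
    survives integration. *)
Lemma is_derive_torus_integral (k : circle R -> circle R -> R) (mu : M1 R) x :
  torus_fun_C2 k ->
  is_derive (0 : R) 1 (fun s => \int[mu]_y k (x + cproj s) y)
    (\int[mu]_y torus_dx k x y).
Proof.
move=> /torus_C2_bounds[K K0 [kK dkK _ kT]].
have kL z u v : `|k z u - k z v| <= K * mdist u v.
  by have := kK z z u v; rewrite mdistxx add0r.
have dkL z u v : `|torus_dx k z u - torus_dx k z v| <= K * mdist u v.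
  by have := dkK z z u v; rewrite mdistxx add0r.
apply: (@is_derive_quadratic _ _ K) => s.
have ik z := lipschitz_circle_integrable mu (kL z).
have idk := lipschitz_circle_integrable mu (dkL x).
rewrite cproj0 addr0 -RintegralZl// -RintegralB// -RintegralB//.
- rewrite -[X in `|X|]subr0.
  (* This is a Lipschitz constant in [y] of the remainder, one summand for each of its three
     terms. *)
  apply: (@Rintegral_near_cst _ _ _ (K + K + `|s| * K)) => [u v|v _].
    rewrite !mulrDl; set a := k _ _; set b := k _ u; set c := torus_dx _ _ _.
    set a' := k _ _; set b' := k _ _; set c' := torus_dx _ _ _.
    have -> : a - b - s * c - (a' - b' - s * c') =
        (a - a') - (b - b') - s * (c - c') by lra.
    rewrite (le_trans (ler_normB _ _))// lerD//.
      by rewrite (le_trans (ler_normB _ _))//; apply: lerD; exact: kL.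
    by rewrite normrM -mulrA ler_wpM2l//; exact: dkL.
  by rewrite subr0; exact: kT.
- exact: (integrableB _ (ik _) (ik _)).
- exact: (integrableZl _ _ idk).
Qed.

End circle_differentiation.

(** The sum of the individual constants dominates each of them; this yields one constant for all
    [f i] and [h i j]. *)
Lemma finite_bound (R : realType) (I : finType) (P : I -> R -> Prop) :
  (forall i K L, K <= L -> P i K -> P i L) ->
  (forall i, exists2 K, 0 <= K & P i K) -> exists2 K, 0 <= K & forall i, P i K.
Proof.
move=> mono exK.
have /choice[k kP] : forall i, exists K, 0 <= K /\ P i K.
  by move=> i; have [K K0 PK] := exK i; exists K.
exists (\sum_i k i) => [|i]; first by apply: sumr_ge0 => i _; have [] := kP i.
apply: mono (kP i).2; rewrite (bigD1 i)//= lerDl.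
by apply: sumr_ge0 => j _; have [] := kP j.
Qed.

(** * A connectedness argument on the torus *)

Section torus.
Variables (R : realType) (n : nat).
Implicit Types (p q : torus R n) (U A : set (torus R n)).

(* The segment from p to q cannot leave U without meeting its boundary. *)
Lemma set_dist_boundary_subset U A p q (delta : R) :
  (delta%:E < set_dist A (boundary U))%E -> 0 <= delta -> A p -> U p ->
  (forall i, mdist (q 0 i) (p 0 i) <= delta) -> U q.
Proof.
move=> dU d0 Ap Up qp.
pose gam (t : R) : torus R n :=
  \row_i (p 0 i + cproj (t * crep (q 0 i - p 0 i))).
have gam0 : gam 0 = p.
  by apply/rowP => i; rewrite mxE mul0r cproj0 addr0.
have gam1 : gam 1 = q.
  by apply/rowP => i; rewrite mxE mul1r crepK addrC subrK.
have gam_ball s t i : mdist (gam s 0 i) (gam t 0 i) <= `|s - t|.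
  rewrite !mxE; apply: le_trans (mdist_add _ _ _ _) _.
  rewrite mdistxx add0r -mulrBl normrM ler_piMr//; exact: crep_norm_le1.
have cgam : continuous gam.
  move=> t; apply/cvg_ballP => e e0; near=> s; split => // i j.
  rewrite ord1 ballEmdist /=; apply: le_lt_trans (gam_ball _ _ _) _.
  by near: s; apply: cvgr_dist_lt.
(* Points of the segment stay within [delta] of [p], which is in [A]. *)
have nb t : 0 <= t <= 1 -> ~ boundary U (gam t).
  move=> /andP[t0 t1] bt.
  have : (set_dist A (boundary U) <= (torus_dist p (gam t))%:E)%E.
    by apply: ereal_inf_lbound; exists (p, gam t).
  apply/negP; rewrite -ltNge; apply: le_lt_trans dU; rewrite lee_fin.
  apply: bigmax_le => // i _; rewrite -{1}gam0 metric_sym !mxE.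
  apply: le_trans (mdist_add _ _ _ _) _.
  rewrite mdistxx add0r mul0r subr0 normrM.
  apply: le_trans (qp i); rewrite ger0_norm// ler_piMl//.
pose B := `[0, 1]%classic `&` (gam @^-1` U).
(* As the segment avoids the boundary, [U] can be replaced by its interior or its closure, which
   shows [B] to be both relatively open and closed in [0, 1]. *)
have BE V : U° `<=` V -> V `<=` closure U ->
    B = `[0, 1]%classic `&` (gam @^-1` V).
  move=> UV VU; apply/seteqP; split => t [t01 gt]; have t01' : 0 <= t <= 1 by
    move: t01; rewrite /= in_itv.
    split=> //; apply: UV; apply: contrapT => nI.
    apply: (nb t) => //; split => //.
    exact: subset_closure.
  split=> //; apply: (@interior_subset _ U); apply: contrapT => nI.
    apply: (nb t) => //; split => //.
  exact: VU.
have UU : U° `<=` closure U.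
  exact: subset_trans (@interior_subset _ _) (@subset_closure _ _).
have : B 1.
  rewrite (_ : B = `[0, 1]%classic); first by rewrite /= in_itv /= ler01 lexx.
  apply: segment_connected.
  - by exists 0; split; rewrite /= ?in_itv /= ?lexx ?ler01// gam0.
  - exists (gam @^-1` U°); last exact: BE.
    by apply: open_comp => [t _|]; [exact: cgam|exact: open_interior].
  - exists (gam @^-1` closure U); last exact: BE.
    by apply: closed_comp => [t _|]; [exact: cgam|exact: closed_closure].
by move=> [_]; rewrite /= gam1.
Unshelve. all: by end_near. Qed.

End torus.

(** * The maps driven by a network state and their regularity *)

Section network.
Variables (R : realType) (N1 N2 : nat).
Local Notation N := (N1 + N2)%N.
Variables (f : 'I_N -> circle R -> circle R).
Variables (h : 'I_N -> 'I_N -> circle R -> circle R -> R).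
Hypothesis f_C2 : forall i, circle_C2 (f i).
Hypothesis h_C2 : forall i j, torus_fun_C2 (h i j).
Implicit Types (eta : state R N) (mu : state R N1) (nu : state R N2).

Lemma join_state_rshift mu nu i : join_state mu nu (rshift N1 i) = nu i.
Proof. by rewrite /join_state -[rshift _ _]/(unsplit (inr i)) unsplitK. Qed.

Lemma join_stateK eta : join_state (Pi1 eta) (Pi2 eta) = eta.
Proof.
apply/funext => k; rewrite /join_state -[RHS](congr1 eta (splitK k)).
by case: (fintype.split k).
Qed.

Definition mean_field eta i (x : circle R) : R :=
  \sum_j \int[eta j]_y h i j x y.

Definition mean_field_derive eta i (x : circle R) : R :=
  \sum_j \int[eta j]_y torus_dx (h i j) x y.

Lemma Fmap_derive eta i x : circle_derivable (Fmap f h eta i) x /\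
  circle_derive (Fmap f h eta i) x =
  circle_derive (f i) (x + cproj (mean_field eta i x)) *
  (1 + mean_field_derive eta i x).
Proof.
apply: (@is_circle_derive_comp _ (f i) (mean_field eta i)).
  by have [df _] := f_C2 i.
have := is_derive_sum (fun j => is_derive_torus_integral (eta j) x (h_C2 i j)).
by rewrite fct_sumE.
Qed.

Lemma continuous_Fmap eta i : continuous (Fmap f h eta i).
Proof.
by apply: circle_derivable_continuous => x; have [] := Fmap_derive eta i x.
Qed.

(** Dirac masses are sent to Dirac masses, and these determine their points, so the choice in [Gmap]
    is unique and never the default. *)
Lemma GmapE mu (x : torus R N2) : Gmap f h mu x =
  \row_i Fmap f h (join_state mu (diracs x)) (rshift N1 i) (x 0 i).
Proof.
have FopE i (A : set (circle R)) : measurable A ->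
    Fop2 f h mu (diracs x) i A =
    \d_(Fmap f h (join_state mu (diracs x)) (rshift N1 i) (x 0 i)) A.
  move=> mA; rewrite /Fop2 /Pi2 /Fop transferE; last exact: continuous_Fmap.
  by rewrite join_state_rshift.
apply: xget_subset1; first by move=> i A mA; rewrite FopE// /diracs mxE.
move=> y z Hy Hz; apply/rowP => i; apply: dirac_circle_inj => A mA.
by have := Hy i A mA; rewrite (Hz i A mA).
Qed.

Definition lipschitz2 (K : R) (k : circle R -> circle R -> R) :=
  forall x x' y y',
    `|k x y - k x' y'| <= K * (mdist x x' + mdist y y').

Definition network_bound (K : R) :=
  [/\ forall i j, lipschitz2 K (h i j),
      forall i j, lipschitz2 K (torus_dx (h i j)),
      forall i j x y, `|torus_dx (h i j) x y| <= K,
      forall i x y,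
        `|circle_derive (f i) x - circle_derive (f i) y| <= K * mdist x y &
      forall i x, `|circle_derive (f i) x| <= K].

Lemma lipschitz2S K L k : K <= L -> lipschitz2 K k -> lipschitz2 L k.
Proof.
move=> KL kK x x' y y'; apply: le_trans (kK _ _ _ _) _.
by rewrite ler_wpM2r// addr_ge0 ?mdist_ge0.
Qed.

Lemma network_bound_ex : exists2 K, 0 <= K & network_bound K.
Proof.
have [|ij|Kh Kh0 hK] := @finite_bound R _ (fun (ij : 'I_N * 'I_N) K =>
    let k := h ij.1 ij.2 in [/\ lipschitz2 K k, lipschitz2 K (torus_dx k) &
      forall x y, `|torus_dx k x y| <= K]).
- move=> ij K L KL [/= H1 H2 H3]; split => [||x y]; try exact: lipschitz2S KL _.
  exact: le_trans KL.
- by have [K K0 [H1 H2 H3 _]] := torus_C2_bounds (h_C2 ij.1 ij.2); exists K.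
have [|i|Kf Kf0 fK] := @finite_bound R _ (fun i K =>
    (forall x y, `|circle_derive (f i) x - circle_derive (f i) y| <=
       K * mdist x y) /\
    (forall x, `|circle_derive (f i) x| <= K)).
- move=> i K L KL [H1 H2]; split=> [x y|x]; last exact: le_trans KL.
  by apply: le_trans (H1 _ _) _; rewrite ler_wpM2r// mdist_ge0.
- have [_ cf] := f_C2 i; have [K K0 KL] := cont_diff1_circle_lipschitz cf.
  have [K' K'0 K'L] := periodic_bounded cf.1.
  exists (K + K'); first exact: addr_ge0.
  split=> [x y|x]; last by rewrite (le_trans (K'L x))// lerDr.
  by apply: le_trans (KL _ _) _; rewrite ler_wpM2r ?mdist_ge0// lerDl.
exists (Kh + Kf); first exact: addr_ge0.
split=> [i j|i j|i j x y|i x y|i x].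
- by have [H _ _] := hK (i, j); apply: lipschitz2S H; rewrite lerDl.
- by have [_ H _] := hK (i, j); apply: lipschitz2S H; rewrite lerDl.
- by have [_ _ H] := hK (i, j); rewrite (le_trans (H x y))// lerDl.
- apply: le_trans ((fK i).1 x y) _.
  by rewrite ler_wpM2r ?mdist_ge0// lerDr.
- by rewrite (le_trans ((fK i).2 x))// lerDr.
Qed.

(** Both states share their Group 1 measures, so there only the move from [x] to [z] counts; in
    Group 2 each measure is moreover concentrated within [D] of [p]. The kernel [k] is general
    because both [h i] and its derivative are needed. *)
Lemma join_state_integral_close
    (k : 'I_N -> circle R -> circle R -> R) (K D : R) mu nu
    (p : torus R N2) (x z : circle R) : 0 <= K -> 0 <= D ->
  (forall j, lipschitz2 K (k j)) ->
  (forall j y, msupport (nu j) y -> mdist y (p 0 j) <= D) ->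
  `|\sum_j \int[join_state mu nu j]_y k j z y -
    \sum_j \int[join_state mu (diracs p) j]_y k j x y|
  <= N%:R * (K * (mdist z x + D)).
Proof.
move=> K0 D0 kK suppD; rewrite -sumrB (le_trans (ler_norm_sum _ _ _))//.
have kL j u v w : `|k j w u - k j w v| <= K * mdist u v.
  by have := kK j w w u v; rewrite mdistxx add0r.
rewrite -[N in leRHS]card_ord mulr_natl -sumr_const; apply: ler_sum => j _.
rewrite /join_state; case: (fintype.split j) => i.
  have I w := lipschitz_circle_integrable (mu i) (fun u v => kL j u v w).
  rewrite -RintegralB//.
  rewrite -[X in `|X|]subr0.
  apply: (@Rintegral_near_cst _ _ _ (K + K)) => [u v|y _].
    have -> : k j z u - k j x u - (k j z v - k j x v) =
        (k j z u - k j z v) - (k j x u - k j x v) by lra.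
    rewrite mulrDl (le_trans (ler_normB _ _))//.
    by apply: lerD; exact: kL.
  rewrite subr0; apply: le_trans (kK _ _ _ _ _) _.
  by rewrite mdistxx ler_wpM2l// lerD2l.
rewrite [X in _ - X](Rintegral_dirac _ (fun u v => kL j u v x)).
apply: (Rintegral_near_cst (fun u v => kL j u v z)) => y /suppD yD.
by apply: le_trans (kK _ _ _ _ _) _; rewrite ler_wpM2l// lerD2l.
Qed.

(** * Comparison with a synchronized Group 2 *)

Section contraction.
Variable K : R.
Hypotheses (K0 : 0 <= K) (hfK : network_bound K).

(* The mean fields of (mu, nu) and (mu, delta_p), and likewise their
   derivatives, differ by at most 2 N K D; the two summands come from the
   variation of f' and from that of the derivative of the mean field. *)
Definition network_cst : R :=
  K * (1 + 2 * N%:R * K) * (1 + N%:R * K) + 2 * N%:R * K * K.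

Lemma network_cst_ge0 : 0 <= network_cst.
Proof.
by rewrite /network_cst addr_ge0 ?mulr_ge0 ?addr_ge0 ?mulr_ge0 ?ler0n.
Qed.

Variables (mu : state R N1) (nu : state R N2) (p : torus R N2) (D : R).
Hypothesis D0 : 0 <= D.
Hypothesis suppD : forall j y, msupport (nu j) y -> mdist y (p 0 j) <= D.
Local Notation F := (Fmap f h (join_state mu nu)).
Local Notation F0 := (Fmap f h (join_state mu (diracs p))).

Let M_ge0 : 0 <= N%:R :> R. Proof. exact: ler0n. Qed.

(** The 1 accounts for the move from [x] to [z], the rest for the change of the mean field. *)
Lemma Fmap_arg_close i (x z : circle R) : mdist z x <= D ->
  mdist (z + cproj (mean_field (join_state mu nu) i z))
        (x + cproj (mean_field (join_state mu (diracs p)) i x)) <=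
  (1 + 2 * N%:R * K) * D.
Proof.
move=> zx; apply: le_trans (mdist_add _ _ _ _) _.
have [hK _ _ _ _] := hfK.
have := join_state_integral_close mu x z K0 D0 (hK i) suppD.
rewrite -!/(mean_field _ _ _) => H; rewrite mulrDl mul1r lerD// (le_trans H)//.
rewrite -!mulrA [leRHS]mulrCA ler_wpM2l// [leRHS]mulrCA ler_wpM2l//; lra.
Qed.

Lemma Fmap_close i (x z : circle R) : mdist z x <= D ->
  mdist (F i z) (F0 i x) <= network_cst * D.
Proof.
move=> zx; have [_ _ _ _ fK] := hfK.
have H := Fmap_arg_close i zx.
apply: (@le_trans _ _ (K * ((1 + 2 * N%:R * K) * D))).
  apply: (@le_trans _ _ (K * mdist
        (z + cproj (mean_field (join_state mu nu) i z))
        (x + cproj (mean_field (join_state mu (diracs p)) i x)))).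
    by apply: (@circle_mean_value _ (f i)) => // y; have [df _] := f_C2 i.
  by rewrite ler_wpM2l.
(* The constant K (1 + 2 N K) found here is below [network_cst], which also has to serve for the
   derivatives. *)
rewrite mulrA ler_wpM2r// /network_cst.
have MK : 0 <= N%:R * K by rewrite mulr_ge0.
have KMK : 0 <= K * (1 + 2 * N%:R * K).
  by rewrite mulr_ge0// addr_ge0// -mulrA mulr_ge0.
rewrite [_ * (1 + N%:R * K)]mulrDr mulr1 -addrA lerDl.
by rewrite addr_ge0 ?(mulr_ge0 KMK)// !mulr_ge0.
Qed.

(** By the chain rule the derivatives are f'(a) (1 + u) and f'(b) (1 + v); their difference is
    (f'(a) - f'(b)) (1 + u) + f'(b) (u - v). *)
Lemma Fmap_derive_close i (x z : circle R) : mdist z x <= D ->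
  `|circle_derive (F i) z| <= `|circle_derive (F0 i) x| + network_cst * D.
Proof.
move=> zx; have [_ dK bK fL fK] := hfK.
have H := Fmap_arg_close i zx.
have HD := join_state_integral_close mu x z K0 D0 (dK i) suppD.
have bD : `|mean_field_derive (join_state mu nu) i z| <= N%:R * K.
  rewrite (le_trans (ler_norm_sum _ _ _))//.
  rewrite -[N in leRHS]card_ord mulr_natl -sumr_const; apply: ler_sum => j _.
  rewrite -[X in `|X|]subr0; apply: (@Rintegral_near_cst _ _ _ K) => [u v|y _].
    by have := dK i j z z u v; rewrite mdistxx add0r.
  by rewrite subr0.
rewrite (Fmap_derive _ i z).2 (Fmap_derive _ i x).2 -lerBlDl.
rewrite -!/(mean_field_derive _ _ _) in HD bD *.
move: (z + _) (x + _) H => a b ab.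
move: (mean_field_derive _ i z) (mean_field_derive _ i x) HD bD => u v uv ub.
apply: le_trans (lerB_dist _ _) _.
have -> : circle_derive (f i) a * (1 + u) - circle_derive (f i) b * (1 + v) =
  (circle_derive (f i) a - circle_derive (f i) b) * (1 + u) +
  circle_derive (f i) b * (u - v) by lra.
rewrite (le_trans (ler_normD _ _))// /network_cst [leRHS]mulrDl.
rewrite lerD// normrM.
  rewrite (_ : _ * D = K * ((1 + 2 * N%:R * K) * D) * (1 + N%:R * K));
    last ring.
  apply: ler_pM => //; first by rewrite (le_trans (fL _ _ _))// ler_wpM2l.
  by rewrite (le_trans (ler_normD _ _))// normr1 lerD2l.
rewrite (_ : _ * D = K * (N%:R * (K * (D + D)))); last ring.
apply: ler_pM => //; apply: le_trans uv _.
by rewrite !ler_wpM2l// lerD2r.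
Qed.

End contraction.

Lemma Fop2E mu nu i : Fop2 f h mu nu i =
  transfer (Fmap f h (join_state mu nu) (rshift N1 i)) (nu i).
Proof. by rewrite /Fop2 /Pi2 /Fop join_state_rshift. Qed.

(** The other factors of the product are nonempty, so [x] can be completed by points of them. *)
Lemma state_support_ex nu j x : msupport (nu j) x ->
  exists2 p, state_support nu p & p 0 j = x.
Proof.
move=> sx; have /choice[q qP] : forall i, exists y, msupport (nu i) y.
  by move=> i; exact: msupport_neq0.
exists (\row_i if i == j then x else q i); last by rewrite mxE eqxx.
by move=> i; rewrite mxE; case: eqP => [->|_].
Qed.

(** Unlike the arc length in [support_size], a bound on pairwise distances passes to image measures
    without exhibiting arcs. *)
Definition support_diam_le nu (D : R) := forall j x y,
  msupport (nu j) x -> msupport (nu j) y -> mdist x y <= D.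

Lemma small_support_diam eps U nu : small_support eps U nu ->
  support_diam_le nu eps.
Proof.
move=> [nu_eps _] j x y sx sy.
have : support_length (nu j) < eps.
  by apply: le_lt_trans nu_eps; exact: le_bigmax.
move=> /inf_lt[|l [I [a [bl [br [_ ->]]]] suppI] /ltW le].
  (* The whole circle, as the arc from -1/2 to 1/2, shows that the infimum is taken over a nonempty
     set. *)
  exists 1; exists setT => //; exists (- 2^-1), true, false.
  split; first by rewrite ler01 lexx.
  apply/seteqP; split => // z _; exists (crep z); last exact: crepK.
  rewrite /= in_itv /=; have /andP[? ?] := crep_bounds z.
  by apply/andP; split; lra.
have weak s : s \in Interval (BSide bl a) (BSide br (a + l)) -> a <= s <= a + l.
  by case: bl br {suppI} => -[]; rewrite in_itv /= => /andP[? ?];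
    apply/andP; split => //; exact: ltW.
have [s /= /weak/andP[s1 s2] <-] := suppI _ sx.
have [t /= /weak/andP[t1 t2] <-] := suppI _ sy.
apply: le_trans (mdist_cproj _ _) _; apply: le_trans le.
by rewrite ler_norml; apply/andP; split; lra.
Qed.

Lemma Fop2_contraction K mu nu U (D delta lambda lambda' : R) :
  0 <= K -> network_bound K -> 0 <= D -> 0 <= lambda' ->
  lambda + network_cst K * D <= lambda' -> network_cst K * D <= delta ->
  Gmap f h mu @` U `<=` U ->
  (delta%:E < set_dist (Gmap f h mu @` closure U) (boundary U))%E ->
  (forall x i, U x -> `|gder f h mu i x| <= lambda) ->
  state_support nu `<=` U -> support_diam_le nu D ->
  state_support (Fop2 f h mu nu) `<=` U /\
  support_diam_le (Fop2 f h mu nu) (lambda' * D).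
Proof.
move=> K0 hfK D0 l0 lD dD GU dU gU suppU diamD.
have suppD p : state_support nu p ->
    forall j y, msupport (nu j) y -> mdist y (p 0 j) <= D.
  by move=> sp j y sy; exact: (diamD _ _ _ sy (sp j)).
pose F i := Fmap f h (join_state mu nu) (rshift N1 i).
split.
  move=> q sq; have /choice[x xP] : forall i, exists y, msupport (nu i) y.
    by move=> i; exact: msupport_neq0.
  pose p : torus R N2 := \row_i x i.
  have sp : state_support nu p by move=> i; rewrite mxE.
  have Up : U p := suppU _ sp.
  apply: (@set_dist_boundary_subset _ _ _ _ (Gmap f h mu p) _ _ dU).
  - by apply: le_trans dD; rewrite mulr_ge0// network_cst_ge0.
  - by exists p => //; exact: subset_closure.
  - by apply: GU; exists p.
  (* A point of the image support is only approximated by images of support points, hence the margin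
     [e]. *)
  - move=> i; apply: le_trans dD; apply/ler_addgt0Pr => e e0.
    have := sq i; rewrite Fop2E => /msupport_transfer sqi.
    have [|z sz qz] := sqi _ _ e0; first exact: continuous_Fmap.
    apply: le_trans (metric_triangle _ (F i z) _) _.
    rewrite addrC GmapE mxE; apply: lerD (ltW qz).
    by apply: Fmap_close => //; [exact: suppD|exact: suppD].
move=> j x y; rewrite !Fop2E => /msupport_transfer sx /msupport_transfer sy.
apply/ler_addgt0Pr => e e0; have e20 : 0 < e / 2 by rewrite divr_gt0.
have cF : continuous (F j) by exact: continuous_Fmap.
have [z sz xz] := sx _ cF e20; have [w sw yw] := sy _ cF e20.
apply: le_trans (metric_triangle _ (F j z) _) _.
rewrite [e]splitr addrCA lerD ?(ltW xz)//.
apply: le_trans (metric_triangle _ (F j w) _) _.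
rewrite lerD//; last by rewrite metric_sym ltW.
apply: (@le_trans _ _ (lambda' * mdist z w)); last first.
  by rewrite ler_wpM2l// (diamD j).
(* With [w] as coordinate [j] of [p], the geodesic from [w] to [z] stays within [D] of that
   coordinate, and the reference derivative there is [gder] at a point of [U]. *)
have [p sp pw] := state_support_ex sw.
apply: circle_mean_value => // [v|v vw].
  by have [] := Fmap_derive (join_state mu nu) (rshift N1 j) v.
apply: le_trans lD.
apply: (@le_trans _ _ (`|gder f h mu j p| + network_cst K * D)).
  apply: Fmap_derive_close => //; first exact: suppD.
  by rewrite pw (le_trans vw)// (diamD j).
by rewrite lerD2r gU//; exact: suppU.
Qed.

(** Over an empty index set the maximum would be its default [-oo]. *)
Lemma wasserstein_state_ge0 (eta eta' : state R N) : (0 < N)%N ->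
  (0 <= wasserstein_state eta eta')%E.
Proof.
move=> N0; pose i := Ordinal N0.
by rewrite (le_trans (wasserstein_ge0 (eta i) (eta' i)))//; exact: le_bigmax.
Qed.

(** The comparison state keeps [mu] and has Dirac masses at a point of the support of [nu]: Group 1
    then contributes 0 and Group 2 at most [D]. *)
Lemma wasserstein_to_part_sync_le mu nu U D : (0 < N)%N -> 0 <= D ->
  state_support nu `<=` U -> support_diam_le nu D ->
  (wasserstein_to (join_state mu nu) (part_sync U) <= D%:E)%E.
Proof.
move=> N0 D0 suppU diamD.
have /choice[x xP] : forall i, exists y, msupport (nu i) y.
  by move=> i; exact: msupport_neq0.
pose p : torus R N2 := \row_i x i.
apply: (@le_trans _ _ (wasserstein_state (join_state mu nu)
  (join_state mu (diracs p)))).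
  apply: ereal_inf_lbound; exists (join_state mu (diracs p)) => //.
  exists mu => //; exists p => //; apply: suppU => i; rewrite mxE; exact: xP.
apply: bigmax_le => [|k _]; first exact: leNye.
rewrite /join_state; case: (fintype.split k) => i.
  by apply: ge_ereal_sup => _ [phi _ <-]; rewrite subrr lee_fin.
rewrite /diracs; apply: wasserstein_dirac_le => y sy.
by apply: (diamD _ _ _ sy); rewrite mxE; exact: xP.
Qed.

End network.

(** * Choice of the support size and iteration *)

Theorem theorem4p1 (R : realType) (N1 N2 : nat)
    (hN1 : (0 < N1)%N) (hN2 : (0 < N2)%N)
    (f : 'I_(N1 + N2) -> circle R -> circle R)
    (h : 'I_(N1 + N2) -> 'I_(N1 + N2) -> circle R -> circle R -> R)
    (f_C2 : forall i, circle_C2 (f i))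
    (h_C2 : forall i j, torus_fun_C2 (h i j))
    (N' : set (state R N1)) (U : set (torus R N2)) (eps0 delta lambda : R)
    (eps0_gt0 : 0 < eps0) (delta_gt0 : 0 < delta)
    (lambda_ge0 : 0 <= lambda) (lambda_lt1 : lambda < 1)
    (A1 : forall mu, N' mu ->
      [/\ Gmap f h mu @` U `<=` U,
          (delta%:E < set_dist (Gmap f h mu @` closure U) (boundary U))%E &
          forall x i, U x -> `|gder f h mu i x| <= lambda])
    (NN : set (state R N1)) (NN_sub : NN `<=` N')
    (A2 : forall (n : nat) (eps : R), 0 < eps -> eps <= eps0 ->
      [set Pi1 (iter n (Fop f h) (join_state mu nu)) |
        mu in NN & nu in small_support eps U] `<=` N') :
  exists eps : R, [/\ 0 < eps, eps <= eps0 &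
    forall mu nu, NN mu -> small_support eps U nu ->
      wasserstein_to (iter n (Fop f h) (join_state mu nu)) (part_sync U)
        @[n --> \oo] --> 0%E].
Proof.
have N0 : (0 < N1 + N2)%N by rewrite addn_gt0 hN1.
have [K K0 hfK] := network_bound_ex f_C2 h_C2.
pose C := network_cst N1 N2 K; have C0 : 0 <= C := network_cst_ge0 N1 N2 K0.
(* The midpoint of [lambda] and 1 leaves room (1 - lambda) / 2 for the error C D in the
   derivatives. *)
pose lambda' := (1 + lambda) / 2.
have l0 : 0 <= lambda' by rewrite /lambda'; lra.
have l1 : lambda' < 1 by rewrite /lambda'; lra.
(* The allowance for C eps: [delta] keeps the supports in [U], the other term keeps the contraction
   rate below [lambda']. *)
pose m := Num.min delta ((1 - lambda) / 2).
have m0 : 0 < m by rewrite lt_min delta_gt0 divr_gt0// subr_gt0.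
(* Dividing by C + 1 covers the case C = 0. *)
pose eps := Num.min eps0 (m / (C + 1)).
have C1 : 0 < C + 1 by lra.
have e0 : 0 < eps by rewrite lt_min eps0_gt0 divr_gt0.
have ee0 : eps <= eps0 by rewrite ge_min lexx.
have Ceps : C * eps <= m.
  have : eps <= m / (C + 1) by rewrite ge_min lexx orbT.
  rewrite ler_pdivlMr// => /(le_trans _)->//.
  by rewrite mulrC ler_wpM2l ?ltW//; lra.
exists eps; split=> // mu nu NNmu nuU.
pose eta n := iter n (Fop f h) (join_state mu nu).
have N'eta n : N' (Pi1 (eta n)).
  by apply: (A2 n _ e0 ee0); exists mu => //; exists nu.
(* A2 has placed Group 1 in [N'] at every time, so A1 applies at each step; the diameters never
   exceed [eps], so the same constants serve throughout. *)
have inv n : state_support (Pi2 (eta n)) `<=` U /\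
    support_diam_le (Pi2 (eta n)) (lambda' ^+ n * eps).
  elim: n => [|n [suppU diamD]].
    rewrite expr0 mul1r; have -> : Pi2 (eta 0) = nu.
      by apply/funext => i; rewrite /Pi2 /eta /= join_state_rshift.
    by split; [exact: nuU.2|exact: small_support_diam nuU].
  have -> : Pi2 (eta n.+1) = Fop2 f h (Pi1 (eta n)) (Pi2 (eta n)).
    by rewrite /Fop2 join_stateK.
  have [GU dU gU] := A1 _ (N'eta n).
  have De : lambda' ^+ n * eps <= eps.
    by rewrite ler_piMl ?exprn_ile1 ?(ltW e0) ?(ltW l1).
  have CD : C * (lambda' ^+ n * eps) <= m.
    by apply: le_trans Ceps; rewrite ler_wpM2l.
  rewrite exprS -mulrA.
  apply: (Fop2_contraction _ _ K0 hfK _ _ _ _ GU dU gU) => //.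
  - by rewrite mulr_ge0 ?exprn_ge0// ltW.
  - have : m <= (1 - lambda) / 2 by rewrite ge_min lexx orbT.
    by rewrite -/C /lambda'; lra.
  - by apply: le_trans CD _; rewrite ge_min lexx.
apply: (@squeeze_cvge _ _ _ _ (cst 0%E) _
    (fun n => (lambda' ^+ n * eps)%:E)).
- apply: nearW => n; apply/andP; split.
    by apply: le_ereal_inf_tmp => _ [eta' _ <-]; exact: wasserstein_state_ge0.
  have [suppU diamD] := inv n.
  rewrite -[iter _ _ _](join_stateK (eta n)).
  apply: wasserstein_to_part_sync_le => //.
  by rewrite mulr_ge0 ?exprn_ge0// ltW.
- exact: cvg_cst.
- apply: cvg_EFin; first exact: nearW.
  rewrite (_ : _ \o _ = geometric eps lambda').
    by apply: cvg_geometric; rewrite ger0_norm.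
  by apply/funext => n; rewrite /= mulrC.
Qed.
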